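(* Let $q=\omega(1)$ as $n\to\infty$ and fix $d$ and $\lambda\ne0$. Then counting triangles distinguishes between $G\sim\mathrm{SBM}(n,q,d,\lambda)$ and $G(n,\frac dn)$ with probability $1-o(1)$. That is, there is a sequence of tests, each depending only on the number of triangles of the observed graph, whose error probability tends to $0$ as $n\to\infty$ both when the graph is drawn from $\mathrm{SBM}(n,q,d,\lambda)$ and when it is drawn from $G(n,\frac dn)$.
   Context: Stochastic block model $\mathrm{SBM}(n,q,d,\lambda)$: $q=q_n\ge2$ is an integer and $a=a_n>0$, $b=b_n>0$ are determined by $d=\frac{a+(q-1)b}{q}$ and $\lambda=\frac{a-b}{a+(q-1)b}$. Each vertex $u\in[n]$ receives a community $\sigma^\star_u\in[q]$ independently and uniformly at random; given $\sigma^\star$, each possible edge $\{u,v\}$ is included independently with probability $a/n$ if $\sigma^\star_u=\sigma^\star_v$ and $b/n$ otherwise. Here $d>0$ and $\lambda$ are constants independent of $n$. $G(n,p)$ is the Erdős–Rényi random graph on $n$ vertices with edge probability $p$. *)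

(* Defs.v *)
From HB Require Import structures.
From mathcomp Require Import all_boot all_order all_algebra.
From mathcomp Require Import all_classical all_reals all_analysis.

Set Implicit Arguments.
Unset Strict Implicit.
Unset Printing Implicit Defensive.

Import Order.TTheory GRing.Theory Num.Theory.
Import numFieldNormedType.Exports.

Local Open Scope ring_scope.

(* A simple graph on the vertex set 'I_n is its edge set, a set of 2-element
   sets of vertices. *)
Definition graph (n : nat) : Type :=
  {E : {set {set 'I_n}} | [forall e in E, #|e| == 2%N]}.

Definition adj (n : nat) (G : graph n) (u v : 'I_n) : bool :=
  [set u; v]%SET \in val G.

Definition triangles (n : nat) (G : graph n) : nat :=
  #|[set T : {set 'I_n} | (#|T| == 3%N) &&
      [forall u in T, forall v in T, (u != v) ==> adj G u v]]|.

(* The law of the random graph whose potential edges {u, v} are present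
   independently with probability p u v; only the values with u < v matter. *)
Definition indep_edges (R : realType) (n : nat) (p : 'I_n -> 'I_n -> R)
    (G : graph n) : R :=
  \prod_(uv : 'I_n * 'I_n | (uv.1 < uv.2)%N)
    (if adj G uv.1 uv.2 then p uv.1 uv.2 else 1 - p uv.1 uv.2).

Definition erdos_renyi (R : realType) (n : nat) (p : R) : graph n -> R :=
  indep_edges (fun _ _ : 'I_n => p).

Definition sbm_given (R : realType) (n q : nat) (a b : R)
    (sigma : {ffun 'I_n -> 'I_q}) : graph n -> R :=
  indep_edges (fun u v : 'I_n =>
    if sigma u == sigma v then a / n%:R else b / n%:R).

(* The communities are not observed: this is the marginal law of the graph,
   averaged over the q ^ n equally likely labellings. *)
Definition sbm (R : realType) (n q : nat) (a b : R) (G : graph n) : R :=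
  \sum_(sigma : {ffun 'I_n -> 'I_q}) (q%:R ^+ n)^-1 * sbm_given a b sigma G.

Definition Prob (R : realType) (n : nat) (law : graph n -> R)
    (A : pred (graph n)) : R :=
  \sum_(G : graph n | A G) law G.

(* Main.v *)
Require Import Defs.
From HB Require Import structures.
From mathcomp Require Import all_boot all_order all_algebra.
From mathcomp Require Import all_classical all_reals all_analysis.
From mathcomp Require Import zify ring lra.

Set Implicit Arguments.
Unset Strict Implicit.
Unset Printing Implicit Defensive.

Import Order.TTheory GRing.Theory Num.Theory.
Import numFieldNormedType.Exports.

Local Open Scope classical_set_scope.
Local Open Scope ring_scope.

(** The idea is that triangles are rare in the Erdos-Renyi graph, with bounded
    mean, and abundant in the block model, with mean of order [q], and that
    the count concentrates in the latter.  The parameters give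
    [a = d (1 + lambda (q - 1))] and [b = d (1 - lambda)], so positivity of
    [b] and, as [q] tends to infinity, of [a] force [0 < lambda < 1].  With
    [alpha = d / n], two vertices labelled [i] and [j] are then adjacent with
    probability [alpha (1 + lambda (q [i = j] - 1))].

    These kernels multiply under composition ([block_kernel_comp]): averaging
    over the uniform label of an intermediate vertex turns the parameters
    [(alpha, lambda)] and [(beta, mu)] into [(alpha beta, lambda mu)].  Closing
    up a path of three, resp. four, kernels shows that a given triangle is
    present with probability [tau = alpha^3 (1 + lambda^3 (q - 1))] and a given
    4-cycle with probability [alpha^4 (1 + lambda^4 (q - 1))].

    For the second moment, expand over ordered pairs of triples [S], [S'].
    - If they share at most one vertex, the two triangles are exactly
      uncorrelated: averaging over the labels of two vertices of [S] outside
      [S'] already gives the constant [tau], whatever the label of the third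
      one ([label_avg_edges_indep]).
    - If they share two vertices, the union of the two triangles contains a
      4-cycle.  There are at most [n^4] such pairs.
    - If they coincide, the pair contributes [tau].

    So with [m = 'C(n, 3) tau] the mean, the variance is at most
    [m + d^4 (1 + lambda^4 (q - 1))], which is [O(m + q)], while [m] is at least
    a constant times [q].  The test answers block model when the number of
    triangles is at least [m / 2]: its error is [O(1 / q)] by Chebyshev's
    inequality under the block model, and by Markov's inequality under the
    Erdos-Renyi law, where the mean number of triangles is at most [d^3]. *)

(** * Subgraph probabilities for independent edges *)

Definition vertex_pairs (n : nat) : {set {set 'I_n}} :=
  [set e : {set 'I_n} | #|e| == 2%N]%SET.

Lemma set2_ord_inj (n : nat) :
  {in [pred uv : 'I_n * 'I_n | (uv.1 < uv.2)%N] &,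
    injective (fun uv => [set uv.1; uv.2]%SET)}.
Proof.
move=> [u v] [u' v']; rewrite !inE /= => uv u'v' /setP eq2.
have := eq2 u; have := eq2 v; have := eq2 u'; have := eq2 v'.
rewrite !inE !eqxx ?orbT /=.
case: (eqVneq u u') uv u'v' => [->|nuu'] uv u'v'.
  by move=> _ _ /=; case: eqP => [vu'|_ /esym/eqP -> //]; move: uv; rewrite vu' ltnn.
move=> _ _ _ /= /esym/eqP uv'.
move: uv; rewrite uv' => v'v; have := eq2 u'.
rewrite !inE eqxx /= uv' => /orP[/eqP E|/eqP E].
  by rewrite uv' E eqxx in nuu'.
by have := ltn_trans u'v' v'v; rewrite E ltnn.
Qed.

Lemma set2_ord_imset (n : nat) :
  [set [set uv.1; uv.2] | uv in [pred uv : 'I_n * 'I_n | uv.1 < uv.2]%N]%SET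
    = vertex_pairs n.
Proof.
apply/setP=> e; rewrite inE; apply/imsetP/cards2P.
  move=> [[u v]]; rewrite inE /= => uv ->; exists u, v; split=> //.
  by apply: contraTneq uv => ->; rewrite ltnn.
move=> [u [v [neq_uv ->]]]; have : (u != v :> nat) by [].
rewrite neq_ltn => /orP[uv|vu]; first by exists (u, v).
by exists (v, u) => //; rewrite finset.setUC.
Qed.

(** Indexing the product by unordered pairs makes the edge set of a graph and
    the index set of the product live in the same type. *)
Lemma indep_edges_set2 (R : realType) (n : nat) (p : 'I_n -> 'I_n -> R)
    (phi : {set 'I_n} -> R) (G : graph n) :
  (forall u v, p u v = phi [set u; v]%SET) ->
  indep_edges p G = \prod_(e in vertex_pairs n)
    (if e \in val G then phi e else 1 - phi e).
Proof.
move=> pphi; rewrite -set2_ord_imset big_imset /=; last exact: set2_ord_inj.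
by apply: eq_bigr => uv _; rewrite /adj pphi.
Qed.

(** Expanding the product over all pairs of [A e + B e], where [A e] is the
    weight of the edge being present and [B e] of its being absent, gives the
    sum over all edge sets; the requirement that the edges of [F] be present
    is imposed by setting [B] to 0 on [F]. *)
Lemma indep_edges_subset (R : realType) (n : nat) (p : 'I_n -> 'I_n -> R)
    (phi : {set 'I_n} -> R) (F : {set {set 'I_n}}) :
  (forall u v, p u v = phi [set u; v]%SET) ->
  F \subset vertex_pairs n ->
  \sum_(G : graph n) indep_edges p G * (F \subset val G)%:R
    = \prod_(e in F) phi e.
Proof.
move=> pphi FV.
(* Outside [vertex_pairs n], the values A = 0 and B = 1 kill the sets that are
   not edge sets of graphs and leave the other terms unchanged. *)
pose A e : R := if e \in vertex_pairs n then phi e else 0.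
pose B e : R :=
  if e \in vertex_pairs n then (if e \in F then 0 else 1 - phi e) else 1.
transitivity (\sum_(E : {set {set 'I_n}} | [forall e in E, #|e| == 2%N])
   \prod_e (if e \in E then A e else B e)).
  rewrite (big_sub (fun E : {set {set 'I_n}} => [forall e in E, #|e| == 2%N])) /=.
  apply: eq_bigr => G _; rewrite (indep_edges_set2 _ pphi).
  case: (boolP (F \subset val G)) => [FG|/fintype.subsetPn[e eF eG]].
    rewrite mulr1 big_mkcond /=; apply: eq_bigr => e _; rewrite /A /B.
    case: ifPn => eV; case: ifPn => // eG.
      by rewrite (contraNF (fun eF => fintype.subsetP FG e eF) eG).
    by have /forall_inP/(_ e eG) := valP G; rewrite inE in eV; rewrite (negPf eV).
  by rewrite mulr0 (bigD1 e) //= (negPf eG) /B (fintype.subsetP FV _ eF) eF mul0r.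
rewrite [RHS](_ : _ = \prod_e (A e + B e)); last first.
  rewrite big_mkcond; apply: eq_bigr => e _; rewrite /A /B.
  case: (boolP (e \in F)) => eF; first by rewrite (fintype.subsetP FV _ eF) addr0.
  by case: ifP; rewrite ?add0r // addrCA subrr addr0.
rewrite bigA_distr big_mkcond /=; apply: eq_bigr => E _.
case: ifPn => // /forall_inPn[e eE ne]; rewrite (bigD1 e) //= eE /A inE.
by rewrite (negPf ne) mul0r.
Qed.

Lemma indep_edges_ge0 (R : realType) (n : nat) (p : 'I_n -> 'I_n -> R)
    (G : graph n) :
  (forall u v, 0 <= p u v <= 1) -> 0 <= indep_edges p G.
Proof.
move=> p01; apply: prodr_ge0 => uv _.
by have /andP[p0 p1] := p01 uv.1 uv.2; case: ifP; rewrite ?subr_ge0.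
Qed.

Definition edges_within (n : nat) (S : {set 'I_n}) : {set {set 'I_n}} :=
  [set e in vertex_pairs n | e \subset S]%SET.

Lemma trianglesE (R : realType) (n : nat) (G : graph n) :
  (triangles G)%:R =
  \sum_(S : {set 'I_n} | #|S| == 3%N) (edges_within S \subset val G)%:R :> R.
Proof.
rewrite /triangles -sum1_card natr_sum big_mkcond /= [RHS]big_mkcond /=.
apply: eq_bigr => S _; rewrite inE; case: eqP => //= _.
rewrite (_ : [forall u in S, _] = (edges_within S \subset val G)); first by case: ifP.
apply/idP/fintype.subsetP.
  move=> /forall_inP clq e; rewrite !inE => /andP[/cards2P[u [v [uv ->]]]].
  rewrite finset.subUset !finset.sub1set => /andP[uS vS].
  by move/forall_inP: (clq u uS) => /(_ v vS); rewrite uv.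
move=> sub; apply/forall_inP=> u uS; apply/forall_inP=> v vS; apply/implyP=> uv.
by apply: sub; rewrite !inE cards2 uv finset.subUset !finset.sub1set uS vS.
Qed.

(** * Averaging over the community labels *)

(** The edge probability of the block model in the parametrization by mean
    and correlation: the second factor has average 1 over a uniform [j]. *)
Definition block_kernel (R : realType) (q : nat) (alpha lam : R) (i j : 'I_q) : R :=
  alpha * (1 + lam * (q%:R * (i == j)%:R - 1)).

Lemma block_kernelC (R : realType) (q : nat) (alpha lam : R) (i j : 'I_q) :
  block_kernel alpha lam i j = block_kernel alpha lam j i.
Proof. by rewrite /block_kernel eq_sym. Qed.

(** The functions [q [i = j] - 1] and 1 span an algebra for averaged
    composition in which they are orthogonal idempotents. *)
Lemma block_kernel_comp (R : realType) (q : nat) (alpha lam beta mu : R)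
    (i l : 'I_q) :
  q%:R^-1 * (\sum_j block_kernel alpha lam i j * block_kernel beta mu j l)
    = block_kernel (alpha * beta) (lam * mu) i l.
Proof.
have q0 : q%:R != 0 :> R by rewrite pnatr_eq0; case: q i l => [[]|].
have sum1 (f : 'I_q -> R) k : \sum_j (k == j)%:R * f j = f k.
  rewrite (bigD1 k) //= eqxx mul1r big1 ?addr0 // => j jk.
  by rewrite eq_sym (negPf jk) mul0r.
have -> : \sum_j block_kernel alpha lam i j * block_kernel beta mu j l =
    \sum_j (alpha * (1 - lam) * (beta * (1 - mu))
      + (i == j)%:R * (alpha * lam * q%:R * (beta * (1 - mu)))
      + (l == j)%:R * (alpha * (1 - lam) * (beta * mu * q%:R))
      + (i == j)%:R * ((j == l)%:R * (alpha * lam * q%:R * (beta * mu * q%:R)))).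
  apply: eq_bigr => j _; rewrite /block_kernel (eq_sym l j); ring.
rewrite !big_split /= sumr_const card_ord !sum1 /block_kernel -mulr_natl.
by field.
Qed.

Definition relabel (n q : nat) (sigma : {ffun 'I_n -> 'I_q}) (z : 'I_n) (j : 'I_q)
  : {ffun 'I_n -> 'I_q} := [ffun u => if u == z then j else sigma u].

Definition label_avg (R : realType) (n q : nat)
    (h : {ffun 'I_n -> 'I_q} -> R) : R :=
  \sum_(sigma : {ffun 'I_n -> 'I_q}) (q%:R ^+ n)^-1 * h sigma.

(** Exchanging the label of [z] with a fresh uniform label is an involution of
    the pairs (labelling, fresh label), hence preserves the uniform law. *)
Lemma label_avg_resample (R : realType) (n q : nat) (z : 'I_n)
    (h : {ffun 'I_n -> 'I_q} -> R) : (0 < q)%N ->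
  label_avg h = label_avg (fun sigma => q%:R^-1 * \sum_j h (relabel sigma z j)).
Proof.
move=> q0; have q0' : q%:R != 0 :> R by rewrite pnatr_eq0 -lt0n.
have swapK : involutive
    (fun s : {ffun 'I_n -> 'I_q} * 'I_q => (relabel s.1 z s.2, s.1 z)).
  move=> [s j] /=; congr pair; last by rewrite ffunE eqxx.
  by apply/ffunP=> u; rewrite !ffunE; case: eqP => // ->.
rewrite /label_avg -!big_distrr /=; congr (_ * _).
rewrite pair_big /= (reindex_inj (inv_inj swapK)) /=.
rewrite (eq_bigr (fun s => h s.1)); last first.
  by move=> [s j] _ /=; rewrite [X in h X](_ : _ = s) //; have [] := swapK (s, j).
rewrite -(pair_bigA _ (fun s (_ : 'I_q) => h s)) /= [in RHS]exchange_big /=.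
by rewrite sumr_const card_ord -[X in _ * X]mulr_natl mulKf.
Qed.

Lemma label_avg_cst (R : realType) (n q : nat) (c : R) : (0 < q)%N ->
  label_avg (fun _ : {ffun 'I_n -> 'I_q} => c) = c.
Proof.
move=> q0; rewrite /label_avg sumr_const card_ffun !card_ord -[LHS]mulr_natl natrX.
by rewrite mulVKf // expf_neq0 // pnatr_eq0 -lt0n.
Qed.

Lemma label_avgZ (R : realType) (n q : nat) (c : R)
    (h : {ffun 'I_n -> 'I_q} -> R) :
  label_avg (fun sigma => c * h sigma) = c * label_avg h.
Proof. by rewrite /label_avg big_distrr; apply: eq_bigr => s _; rewrite mulrCA. Qed.

Lemma eq_label_avg (R : realType) (n q : nat) (h k : {ffun 'I_n -> 'I_q} -> R) :
  h =1 k -> label_avg h = label_avg k.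
Proof. by move=> hk; apply: eq_bigr => s _; rewrite hk. Qed.

(** Averaging over the labels of [z] and then of [y] composes the three kernels
    into one evaluated at [(sigma x, sigma x)], which is constant in [sigma x].
    This constancy is why a factor [g] that depends on the label of [x] may be
    pulled out. *)
Lemma label_avg_triangle (R : realType) (n q : nat) (alpha lam : R)
    (x y z : 'I_n) (g : {ffun 'I_n -> 'I_q} -> R) :
  (0 < q)%N -> x != y -> x != z -> y != z ->
  (forall sigma j, g (relabel sigma y j) = g sigma) ->
  (forall sigma j, g (relabel sigma z j) = g sigma) ->
  label_avg (fun sigma =>
      block_kernel alpha lam (sigma x) (sigma y)
    * block_kernel alpha lam (sigma y) (sigma z)
    * block_kernel alpha lam (sigma x) (sigma z) * g sigma)
  = alpha ^+ 3 * (1 + lam ^+ 3 * (q%:R - 1)) * label_avg g.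
Proof.
move=> q0 xy xz yz gy gz; rewrite -label_avgZ.
rewrite (label_avg_resample z) // [LHS](label_avg_resample y) //.
apply: eq_label_avg => s /=.
rewrite (_ : _ * _ = q%:R^-1 * (\sum_j block_kernel alpha lam (s x) j *
   block_kernel (alpha * alpha) (lam * lam) j (s x)) * g s).
  rewrite block_kernel_comp; congr (_ * _).
  by rewrite /block_kernel eqxx mulr1 !exprS expr0 !mulr1 ?mulrA.
rewrite -mulrA; congr (_ * _); rewrite big_distrl /=; apply: eq_bigr => j _.
rewrite -block_kernel_comp mulrCA -mulrA; congr (_ * _).
rewrite big_distrr big_distrl /=; apply: eq_bigr => k _.
rewrite gz gy !ffunE !eqxx (negPf xy) (negPf xz) (negPf yz).
rewrite [block_kernel _ _ k (s x)]block_kernelC; ring.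
Qed.

(** The 4-cycle is two paths of length two from [x] to [y], through [z] and
    through [w]: their labels are averaged out first. *)
Lemma label_avg_square (R : realType) (n q : nat) (alpha lam : R)
    (x y z w : 'I_n) :
  (0 < q)%N -> uniq [:: x; y; z; w] ->
  label_avg (fun sigma : {ffun 'I_n -> 'I_q} =>
      block_kernel alpha lam (sigma x) (sigma z)
    * block_kernel alpha lam (sigma z) (sigma y)
    * (block_kernel alpha lam (sigma x) (sigma w)
    * block_kernel alpha lam (sigma w) (sigma y)))
  = alpha ^+ 4 * (1 + lam ^+ 4 * (q%:R - 1)).
Proof.
move=> q0; rewrite /= !inE !negb_or -!andbA.
move=> /and5P[xy xz xw yz /and3P[yw zw _]].
rewrite -[RHS](@label_avg_cst _ n q _ q0).
rewrite (label_avg_resample z) // [LHS](label_avg_resample w) //.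
rewrite [LHS](label_avg_resample y) //; apply: eq_label_avg => s /=.
rewrite (_ : \sum_j _ = \sum_j block_kernel (alpha * alpha) (lam * lam) (s x) j *
   block_kernel (alpha * alpha) (lam * lam) j (s x)).
  by rewrite block_kernel_comp /block_kernel eqxx mulr1; ring.
apply: eq_bigr => j _.
rewrite [X in _ = _ * X]block_kernelC -!block_kernel_comp [RHS]mulrCA.
congr (_ * _); rewrite [RHS]big_distrr /=; apply: eq_bigr => k _.
rewrite -[RHS]mulrA; congr (_ * _); rewrite [RHS]big_distrl /=.
apply: eq_bigr => l _; rewrite !ffunE !eqxx.
rewrite (negPf xy) (negPf xz) (negPf xw) (negPf yz) (negPf yw).
by rewrite [w == z]eq_sym (negPf zw).
Qed.

(** * Triangles and squares in the block model *)

(** The extension of [block_kernel] to edges as sets: the image of [e] under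
    [sigma] is a singleton exactly when [e] lies inside one community. *)
Definition pair_weight (R : realType) (n q : nat) (alpha lam : R)
    (sigma : {ffun 'I_n -> 'I_q}) (e : {set 'I_n}) : R :=
  alpha * (1 + lam * (q%:R * (#|sigma @: e| == 1%N)%:R - 1)).

Lemma pair_weight2 (R : realType) (n q : nat) (alpha lam : R)
    (sigma : {ffun 'I_n -> 'I_q}) (x y : 'I_n) :
  pair_weight alpha lam sigma [set x; y]%SET
    = block_kernel alpha lam (sigma x) (sigma y).
Proof. by rewrite /pair_weight imsetU1 imset_set1 cards2 eqSS eqb0 negbK. Qed.

Lemma pair_weight_relabel (R : realType) (n q : nat) (alpha lam : R)
    (sigma : {ffun 'I_n -> 'I_q}) (z : 'I_n) (j : 'I_q) (e : {set 'I_n}) :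
  z \notin e ->
  pair_weight alpha lam (relabel sigma z j) e = pair_weight alpha lam sigma e.
Proof.
move=> ze; rewrite /pair_weight.
rewrite (_ : _ @: e = sigma @: e)//; apply: eq_in_imset => u ue.
by rewrite ffunE; case: eqP ue ze => // -> ->.
Qed.

Lemma set2_neq (T : finType) (u v x y : T) :
  u != x -> u != y -> [set u; v]%SET != [set x; y]%SET.
Proof.
move=> ux uy; apply/eqP=> /setP/(_ u).
by rewrite !inE eqxx (negPf ux) (negPf uy).
Qed.

Lemma card3_split (T : finType) (S : {set T}) (y z : T) :
  #|S| = 3%N -> y \in S -> z \in S -> y != z ->
  exists x, [/\ x != y, x != z & S = [set x; y; z]%SET].
Proof.
move=> S3 yS zS yz.
have : #|S :\ y :\ z|%SET = 1%N.
  move: S3; rewrite (cardsD1 y) yS (cardsD1 z) !inE zS eq_sym yz /=.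
  by move=> /eqP; rewrite !eqSS => /eqP.
move=> /eqP/cards1P[x Ex]; exists x.
have := set11 x; rewrite -Ex !inE => /and3P[xz xy xS]; split=> //.
apply/setP=> u; move/setP/(_ u): Ex; rewrite !inE.
case: (eqVneq u y) => [->|uy]; first by rewrite orbT yS.
case: (eqVneq u z) => [->|uz]; first by rewrite orbT zS.
by rewrite /= => ->; rewrite !orbF.
Qed.

Lemma prod_edges_triangle (R : realType) (n : nat) (phi : {set 'I_n} -> R)
    (x y z : 'I_n) : x != y -> x != z -> y != z ->
  \prod_(e in edges_within [set x; y; z]%SET) phi e
    = phi [set x; y]%SET * phi [set y; z]%SET * phi [set x; z]%SET.
Proof.
move=> xy xz yz.
rewrite (_ : edges_within _ =
    [set x; y] |: ([set y; z] |: [set [set x; z]]))%SET.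
  rewrite big_setU1 ?inE ?negb_or /=; last first.
    by rewrite set2_neq //= finset.setUC (finset.setUC [set x]%SET) set2_neq // eq_sym.
  rewrite big_setU1 ?inE /= ?big_set1 ?mulrA //.
  by rewrite set2_neq // eq_sym.
apply/setP=> e; rewrite !inE; apply/andP/or3P.
  move=> [/cards2P[u [v [uv ->]]]]; rewrite finset.subUset !finset.sub1set !inE -!orbA.
  move=> /andP[/or3P[]/eqP E1 /or3P[]/eqP E2]; move: uv; rewrite E1 E2 ?eqxx // => _;
   solve [by constructor 1|by constructor 2|by constructor 3
   |by rewrite finset.setUC; constructor 1|by rewrite finset.setUC; constructor 2
   |by rewrite finset.setUC; constructor 3].
by case=> /eqP->; rewrite cards2 ?xy ?yz ?xz finset.subUset !finset.sub1set
  !inE !eqxx ?orbT.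
Qed.

Definition triangle_prob (R : realType) (q : nat) (alpha lam : R) : R :=
  alpha ^+ 3 * (1 + lam ^+ 3 * (q%:R - 1)).

Definition square_prob (R : realType) (q : nat) (alpha lam : R) : R :=
  alpha ^+ 4 * (1 + lam ^+ 4 * (q%:R - 1)).

(** The product over [F] plays the part of the factor [g] of
    [label_avg_triangle]; [F] will be empty, or the edge set of a second
    triangle. *)
Lemma label_avg_edges_indep (R : realType) (n q : nat) (alpha lam : R)
    (S : {set 'I_n}) (F : {set {set 'I_n}}) (y z : 'I_n) :
  (0 < q)%N -> #|S| = 3%N -> y \in S -> z \in S -> y != z ->
  (forall e, e \in F -> y \notin e) -> (forall e, e \in F -> z \notin e) ->
  label_avg (fun sigma : {ffun 'I_n -> 'I_q} =>
      \prod_(e in edges_within S) pair_weight alpha lam sigma e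
    * \prod_(e in F) pair_weight alpha lam sigma e)
  = triangle_prob q alpha lam
    * label_avg (fun sigma : {ffun 'I_n -> 'I_q} =>
        \prod_(e in F) pair_weight alpha lam sigma e).
Proof.
move=> q0 S3 yS zS yz Fy Fz.
have [x [xy xz ->]] := card3_split S3 yS zS yz.
rewrite -(label_avg_triangle _ _ q0 xy xz yz) /=.
- by apply: eq_label_avg => s; rewrite prod_edges_triangle // !pair_weight2.
- by move=> s j; apply: eq_bigr => e /Fy; exact: pair_weight_relabel.
- by move=> s j; apply: eq_bigr => e /Fz; exact: pair_weight_relabel.
Qed.

Lemma label_avg_edges_triangle (R : realType) (n q : nat) (alpha lam : R)
    (S : {set 'I_n}) : (0 < q)%N -> #|S| = 3%N ->
  label_avg (fun sigma : {ffun 'I_n -> 'I_q} =>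
      \prod_(e in edges_within S) pair_weight alpha lam sigma e)
  = triangle_prob q alpha lam.
Proof.
move=> q0 S3; have /card_gt1P[y [z [yS zS yz]]] : (1 < #|S|)%N by rewrite S3.
have in0 (u : 'I_n) e : e \in @finset.set0 {set 'I_n} -> u \notin e by rewrite inE.
have := @label_avg_edges_indep R n q alpha lam S finset.set0 y z
  q0 S3 yS zS yz (in0 y) (in0 z).
rewrite [X in _ = _ * X](_ : _ = 1); last first.
  by rewrite -[RHS](@label_avg_cst R n q)//; apply: eq_label_avg => s; rewrite big_set0.
rewrite mulr1 => <-; apply: eq_label_avg => s; by rewrite big_set0 mulr1.
Qed.

(** A common vertex creates no correlation, because the conditional probability
    of a triangle given the label of one of its vertices does not depend on
    that label. *)
Lemma label_avg_edges_two_triangles (R : realType) (n q : nat) (alpha lam : R)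
    (S S' : {set 'I_n}) :
  (0 < q)%N -> #|S| = 3%N -> #|S'| = 3%N -> (#|S :&: S'|%SET <= 1)%N ->
  label_avg (fun sigma : {ffun 'I_n -> 'I_q} =>
      \prod_(e in edges_within S :|: edges_within S')
        pair_weight alpha lam sigma e)
  = triangle_prob q alpha lam ^+ 2.
Proof.
move=> q0 S3 S'3 SS'.
have /card_gt1P[y [z [+ + yz]]] : (1 < #|S :\: S'|%SET)%N.
  by rewrite cardsD S3; case: #|_| SS' => [|[]].
rewrite !inE => /andP[yS' yS] /andP[zS' zS].
rewrite expr2 -{2}(label_avg_edges_triangle _ _ q0 S'3).
rewrite -(label_avg_edges_indep _ _ q0 S3 yS zS yz).
- apply: eq_label_avg => s; rewrite -bigU /=; first by apply: eq_bigl => e; rewrite !inE.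
  rewrite -finset.setI_eq0; apply/eqP/setP=> e; rewrite !inE.
  apply/negP=> /andP[/andP[/eqP e2 eS] /andP[_ eS']].
  have : (#|e| <= #|S :&: S'|%SET)%N by rewrite subset_leq_card // finset.subsetI eS.
  by rewrite e2 => /leq_trans/(_ SS').
- move=> e; rewrite !inE => /andP[_ /fintype.subsetP eS'].
  by apply: contra yS'; apply: eS'.
- move=> e; rewrite !inE => /andP[_ /fintype.subsetP eS'].
  by apply: contra zS'; apply: eS'.
Qed.

Definition square_edges (n : nat) (x y z w : 'I_n) : {set {set 'I_n}} :=
  ([set x; z] |: ([set z; y] |: ([set x; w] |: [set [set w; y]])))%SET.

Lemma label_avg_edges_square (R : realType) (n q : nat) (alpha lam : R)
    (x y z w : 'I_n) : (0 < q)%N -> uniq [:: x; y; z; w] ->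
  label_avg (fun sigma : {ffun 'I_n -> 'I_q} =>
      \prod_(e in square_edges x y z w) pair_weight alpha lam sigma e)
  = square_prob q alpha lam.
Proof.
move=> q0 un; rewrite /square_prob -(label_avg_square _ _ q0 un).
move: un; rewrite /= !inE !negb_or -!andbA.
move=> /and5P[xy xz xw yz /and3P[yw zw _]].
have sw (u v : 'I_n) : u != v -> v != u by rewrite eq_sym.
have flip u v := finset.setUC [set u : 'I_n]%SET [set v]%SET.
apply: eq_label_avg => s; rewrite /square_edges.
rewrite big_setU1 /=; last first.
  rewrite !inE !negb_or set2_neq //= [X in _ && X]set2_neq // andbT.
  by rewrite flip set2_neq // sw.
rewrite big_setU1 /=; last first.
  rewrite !inE !negb_or set2_neq ?(sw _ _ xz) //= set2_neq //.
  by rewrite sw.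
rewrite big_setU1 /=; last by rewrite !inE set2_neq.
by rewrite big_set1 !pair_weight2 !mulrA.
Qed.

(** * The second moment of the triangle count *)

Lemma sbm_subset (R : realType) (n q : nat) (a b alpha lam : R)
    (F : {set {set 'I_n}}) :
  a / n%:R = alpha * (1 + lam * (q%:R - 1)) -> b / n%:R = alpha * (1 - lam) ->
  F \subset vertex_pairs n ->
  \sum_(G : graph n) sbm q a b G * (F \subset val G)%:R
  = label_avg (fun sigma : {ffun 'I_n -> 'I_q} =>
      \prod_(e in F) pair_weight alpha lam sigma e).
Proof.
move=> an bn FV; rewrite /sbm /label_avg.
under eq_bigr do rewrite big_distrl.
rewrite exchange_big /=; apply: eq_bigr => s _.
under eq_bigr do rewrite -mulrA.
rewrite -big_distrr /=; congr (_ * _); apply: indep_edges_subset => // u v.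
rewrite pair_weight2 /block_kernel an bn.
by case: eqP => _; rewrite ?mulr1 ?mulr0 ?sub0r ?mulrN1.
Qed.

Lemma edges_within_sub (n : nat) (S : {set 'I_n}) :
  edges_within S \subset vertex_pairs n.
Proof. by apply/fintype.subsetP=> e; rewrite inE => /andP[]. Qed.

Lemma subset_sum_subset (R : realType) (n : nat) (w : graph n -> R)
   (F F' : {set {set 'I_n}}) : (forall G, 0 <= w G) -> F' \subset F ->
  \sum_G w G * (F \subset val G)%:R <= \sum_G w G * (F' \subset val G)%:R.
Proof.
move=> w0 sub; apply: ler_sum => G _; apply: ler_wpM2l => //.
rewrite ler_nat; case: (boolP (F \subset _)) => // FG.
by rewrite (fintype.subset_trans sub FG).
Qed.

(** Dropping the common edge [x y] of two triangles leaves a 4-cycle, whose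
    probability is easy to compute and small enough. *)
Lemma square_edges_sub (n : nat) (x y z w : 'I_n) : uniq [:: x; y; z; w] ->
  square_edges x y z w \subset
    (edges_within [set x; y; z] :|: edges_within [set x; y; w])%SET.
Proof.
rewrite /= !inE !negb_or -!andbA.
move=> /and5P[xy xz xw yz /and3P[yw zw _]].
apply/fintype.subsetP=> e; rewrite !inE => /or4P[]/eqP->;
  rewrite cards2 ?xz ?xw ?[z == y]eq_sym ?[w == y]eq_sym ?yz ?yw;
  by rewrite /= !finset.subUset !finset.sub1set !inE !eqxx ?orbT.
Qed.

Lemma card3_setI2 (T : finType) (S S' : {set T}) :
  #|S| = 3%N -> #|S'| = 3%N -> S != S' -> (1 < #|S :&: S'|%SET)%N ->
  exists x y z w, [/\ uniq [:: x; y; z; w],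
     S = [set x; y; z]%SET & S' = [set x; y; w]%SET].
Proof.
move=> S3 S'3 neqS /card_gt1P[x [y []]]; rewrite !inE.
move=> /andP[xS xS'] /andP[yS yS'] xy.
have [z [zx zy ES]] := card3_split S3 xS yS xy.
have [w [wx wy ES']] := card3_split S'3 xS' yS' xy.
have rot u : [set u; x; y]%SET = [set x; y; u]%SET.
  by apply/setP=> t; rewrite !inE [RHS]orbC orbA.
exists x, y, z, w; rewrite ES ES' !rot; split=> //=.
rewrite !inE !negb_or xy /= ![x == _]eq_sym ![y == _]eq_sym zx wx zy wy /= andbT.
by apply: contraNneq neqS => zw; rewrite ES ES' zw.
Qed.

Lemma card_triples (n : nat) :
  #|[pred S : {set 'I_n} | #|S| == 3%N]| = 'C(n, 3).
Proof.
by rewrite -[n in RHS]card_ord -card_draws; apply: eq_card => S; rewrite !inE.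
Qed.

(** The pairs of triples that meet in exactly two vertices all have the form
    [({x, y, z}, {x, y, w})], so there are at most [n ^ 4] of them. *)
Lemma sum_triple_pairs_le (R : realType) (n : nat)
    (E : {set 'I_n} -> {set 'I_n} -> R) (A B C : R) :
  0 <= A -> 0 <= B -> 0 <= C ->
  (forall S : {set 'I_n}, #|S| = 3%N -> E S S <= B) ->
  (forall S S' : {set 'I_n}, #|S| = 3%N -> #|S'| = 3%N -> (#|S :&: S'|%SET <= 1)%N ->
     E S S' <= A) ->
  (forall x y z w, uniq [:: x; y; z; w] ->
     E [set x; y; z]%SET [set x; y; w]%SET <= C) ->
  \sum_(S : {set 'I_n} | #|S| == 3%N) \sum_(S' : {set 'I_n} | #|S'| == 3%N) E S S'
  <= 'C(n, 3)%:R ^+ 2 * A + 'C(n, 3)%:R * B + n%:R ^+ 4 * C.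
Proof.
move=> A0 B0 C0 hB hA hC.
pose D := [set ([set t.1.1; t.1.2; t.2.1]%SET, [set t.1.1; t.1.2; t.2.2]%SET)
   | t : ('I_n * 'I_n) * ('I_n * 'I_n)]%SET.
apply: (@le_trans _ _ (\sum_(S : {set 'I_n} | #|S| == 3%N)
    \sum_(S' : {set 'I_n} | #|S'| == 3%N)
      (A + (S' == S)%:R * B + ((S, S') \in D)%:R * C))).
  apply: ler_sum => S /eqP S3; apply: ler_sum => S' /eqP S'3.
  have : 0 <= ((S, S') \in D)%:R * C by rewrite mulr_ge0.
  have [->|neqS] := eqVneq S' S.
    by move=> D0; have := hB S S3; rewrite mul1r; lra.
  move=> D0; rewrite mul0r addr0; have [SS'|SS'] := leqP #|S :&: S'|%SET 1.
    by have := hA S S' S3 S'3 SS'; lra.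
  rewrite eq_sym in neqS.
  have [x [y [z [w [un ES ES']]]]] := card3_setI2 S3 S'3 neqS SS'.
  have -> : (S, S') \in D.
    by apply/imsetP; exists ((x, y), (z, w)); rewrite // ES ES'.
  by have := hC x y z w un; rewrite -ES -ES' mul1r; lra.
under eq_bigr do rewrite !big_split /=.
rewrite !big_split /=; apply: lerD; first apply: lerD.
- by rewrite !sumr_const !card_triples -[A *+ _]mulr_natl -[leLHS]mulr_natl mulrA expr2.
- rewrite -card_triples mulr_natl -sumr_const; apply: ler_sum => S S3.
  rewrite (bigD1 S) //= eqxx mul1r big1 ?addr0 // => S' /andP[_ /negPf->].
  by rewrite mul0r.
- rewrite pair_big /=.
  apply: (@le_trans _ _ (\sum_(p in D) C)).
    rewrite [leRHS]big_mkcond [leLHS]big_mkcond /=; apply: ler_sum => -[S S'] _.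
    by case: ifP; case: ifP; rewrite ?mul1r ?mul0r.
  rewrite sumr_const -[leLHS]mulr_natl ler_wpM2r // -natrX ler_nat.
  apply: leq_trans (leq_imset_card _ _) _.
  by rewrite !card_prod !card_ord !expnS expn0 muln1 !mulnA.
Qed.

(** The factor 4 arises because [(X - m)^2] exceeds [m^2 / 4] on the event. *)
Lemma sum_chebyshev (R : realType) (T : finType) (w X : T -> R) (m v : R) :
  (forall t, 0 <= w t) -> \sum_t w t = 1 -> 0 < m ->
  \sum_t w t * X t = m -> \sum_t w t * X t ^+ 2 <= m ^+ 2 + v ->
  \sum_(t | X t < m / 2) w t <= 4 * v / m ^+ 2.
Proof.
move=> w0 w1 m0 EX EX2.
rewrite ler_pdivlMr ?exprn_gt0 //.
have var : \sum_t w t * (X t - m) ^+ 2 <= v.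
  rewrite (_ : \sum_t _ = \sum_t w t * X t ^+ 2 - 2 * m * (\sum_t w t * X t)
                         + m ^+ 2 * \sum_t w t).
    by rewrite EX w1; lra.
  by rewrite !big_distrr /= -sumrB -big_split; apply: eq_bigr => t _ /=; ring.
apply: (@le_trans _ _ (4 * \sum_t (w t * (X t - m) ^+ 2))); last by rewrite ler_pM2l.
rewrite big_distrr big_distrl big_mkcond /=; apply: ler_sum => t _.
case: ifP => [Xm|_]; last by rewrite mulr_ge0 // mulr_ge0 // exprn_even_ge0.
by rewrite [leRHS]mulrCA ler_wpM2l //; nra.
Qed.

Lemma sum_markov (R : realType) (T : finType) (w X : T -> R) (t : R) :
  (forall x, 0 <= w x) -> (forall x, 0 <= X x) -> 0 < t ->
  \sum_(x | t <= X x) w x <= (\sum_x w x * X x) / t.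
Proof.
move=> w0 X0 t0; rewrite ler_pdivlMr // big_distrl big_mkcond /=.
apply: ler_sum => x _; case: ifP => [tX|_]; first by rewrite ler_wpM2l.
by rewrite mulr_ge0.
Qed.

Lemma sum_triangles (R : realType) (n : nat) (w : graph n -> R) (t : R) :
  (forall S : {set 'I_n}, #|S| = 3%N ->
     \sum_G w G * (edges_within S \subset val G)%:R = t) ->
  \sum_G w G * (triangles G)%:R = 'C(n, 3)%:R * t.
Proof.
move=> wt; under eq_bigr do rewrite trianglesE big_distrr.
rewrite exchange_big /= (eq_bigr (fun=> t)) => [|S /eqP/wt //].
by rewrite sumr_const card_triples mulr_natl.
Qed.

Lemma sum_triangles_sqr (R : realType) (n : nat) (w : graph n -> R) :
  \sum_G w G * (triangles G)%:R ^+ 2 =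
  \sum_(S : {set 'I_n} | #|S| == 3%N) \sum_(S' : {set 'I_n} | #|S'| == 3%N)
    \sum_G w G * ((edges_within S :|: edges_within S')%SET \subset val G)%:R.
Proof.
rewrite [RHS](eq_bigr (fun S : {set 'I_n} => \sum_G \sum_(S' : {set 'I_n} | #|S'| == 3%N)
   w G * ((edges_within S :|: edges_within S')%SET \subset val G)%:R)); last first.
  by move=> S _; rewrite exchange_big.
rewrite [RHS]exchange_big; apply: eq_bigr => G _ /=.
rewrite expr2 trianglesE mulrA -mulrA mulr_suml big_distrr /=.
apply: eq_bigr => S _; rewrite mulr_sumr mulr_sumr; apply: eq_bigr => S' _.
by rewrite finset.subUset -mulnb natrM.
Qed.

Section SBMMoments.

Variables (R : realType) (n q : nat) (a b alpha lam : R).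
Hypotheses (q0 : (0 < q)%N) (alpha0 : 0 <= alpha) (lam0 : 0 <= lam).
Hypothesis an : a / n%:R = alpha * (1 + lam * (q%:R - 1)).
Hypothesis bn : b / n%:R = alpha * (1 - lam).
Hypotheses (an01 : 0 <= a / n%:R <= 1) (bn01 : 0 <= b / n%:R <= 1).

Let q1 : 0 <= q%:R - 1 :> R. Proof. by rewrite subr_ge0 ler1n. Qed.

Lemma sbm_ge0 (G : graph n) : 0 <= sbm q a b G.
Proof.
apply: sumr_ge0 => s _; rewrite mulr_ge0 ?invr_ge0 ?exprn_ge0 //.
by apply: indep_edges_ge0 => u v; case: ifP.
Qed.

Lemma sbm_sum1 : \sum_(G : graph n) sbm q a b G = 1.
Proof.
transitivity (\sum_(G : graph n) sbm q a b G * (finset.set0 \subset val G)%:R).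
  by apply: eq_bigr => G _; rewrite finset.sub0set mulr1.
rewrite (sbm_subset an bn) ?finset.sub0set // -[RHS](@label_avg_cst R n q) //.
by apply: eq_label_avg => s; rewrite big_set0.
Qed.

Lemma sbm_triangles_mean :
  \sum_(G : graph n) sbm q a b G * (triangles G)%:R
  = 'C(n, 3)%:R * triangle_prob q alpha lam.
Proof.
apply: sum_triangles => S S3.
by rewrite (sbm_subset an bn) ?edges_within_sub // label_avg_edges_triangle.
Qed.

Lemma triangle_prob_ge0 : 0 <= triangle_prob q alpha lam.
Proof. by rewrite mulr_ge0 ?exprn_ge0 // addr_ge0 // mulr_ge0 // exprn_ge0. Qed.

Lemma square_prob_ge0 : 0 <= square_prob q alpha lam.
Proof. by rewrite mulr_ge0 ?exprn_ge0 // addr_ge0 // mulr_ge0 // exprn_ge0. Qed.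

Lemma sbm_triangles_second_moment :
  \sum_(G : graph n) sbm q a b G * (triangles G)%:R ^+ 2
  <= ('C(n, 3)%:R * triangle_prob q alpha lam) ^+ 2
     + ('C(n, 3)%:R * triangle_prob q alpha lam
        + n%:R ^+ 4 * square_prob q alpha lam).
Proof.
rewrite sum_triangles_sqr exprMn addrA.
have UV (S S' : {set 'I_n}) :
    (edges_within S :|: edges_within S')%SET \subset vertex_pairs n.
  by rewrite finset.subUset !edges_within_sub.
apply: sum_triple_pairs_le.
- exact/exprn_ge0/triangle_prob_ge0.
- exact: triangle_prob_ge0.
- exact: square_prob_ge0.
- move=> S S3; rewrite finset.setUid (sbm_subset an bn) ?edges_within_sub //.
  by rewrite label_avg_edges_triangle.
- move=> S S' S3 S'3 SS'.
  by rewrite (sbm_subset an bn) // label_avg_edges_two_triangles.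
- move=> x y z w un.
  apply: le_trans (subset_sum_subset sbm_ge0 (square_edges_sub un)) _.
  rewrite (sbm_subset an bn) ?label_avg_edges_square //.
  exact: fintype.subset_trans (square_edges_sub un) (UV _ _).
Qed.

End SBMMoments.

Lemma erdos_renyi_triangles_mean (R : realType) (n : nat) (p : R) :
  \sum_(G : graph n) erdos_renyi p G * (triangles G)%:R = 'C(n, 3)%:R * p ^+ 3.
Proof.
apply: sum_triangles => S S3.
rewrite (@indep_edges_subset _ _ _ (fun=> p)) ?edges_within_sub //.
have /card_gt1P[y [z [yS zS yz]]] : (1 < #|S|)%N by rewrite S3.
have [x [xy xz ->]] := card3_split S3 yS zS yz.
by rewrite prod_edges_triangle // !exprS expr0 mulr1 mulrA.
Qed.

(** The constant 27 is attained at [n = 3]. *)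
Lemma bin3_bounds (n : nat) : (3 <= n)%N ->
  ('C(n, 3) <= n ^ 3)%N /\ (n ^ 3 <= 27 * 'C(n, 3))%N.
Proof.
move=> n3; have := bin_ffact n 3; rewrite !ffactnS ffactn0 /= muln1.
have -> : 3`! = 6%N by [].
case: n n3 => [|[|[|n]]] //= _; rewrite !expnS expn0 muln1; nia.
Qed.

Lemma block_parameters (R : realType) (q : nat) (a b d lambda : R) :
  (0 < q)%N -> 0 < d -> d = (a + (q%:R - 1) * b) / q%:R ->
  lambda = (a - b) / (a + (q%:R - 1) * b) ->
  a = d * (1 + lambda * (q%:R - 1)) /\ b = d * (1 - lambda).
Proof.
move=> q0 d0 dE lE; have q0' : q%:R != 0 :> R by rewrite pnatr_eq0 -lt0n.
have sE : a + (q%:R - 1) * b = d * q%:R by rewrite dE divfK.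
have ab : a - b = lambda * (d * q%:R).
  by rewrite lE sE divfK // mulf_neq0 // gt_eqF.
have bE : b = d * (1 - lambda).
  apply: (mulfI q0'); transitivity (a + (q%:R - 1) * b - (a - b)); first by ring.
  by rewrite sE ab; ring.
by split=> //; rewrite -[a](subrK b) ab bE; ring.
Qed.

(** * Asymptotics and the test *)

Lemma cvg_squeeze_divn (R : realType) (q : nat -> nat) (u : nat -> R) (K : R) :
  q n @[n --> \oo] --> \oo ->
  (\forall n \near \oo, 0 <= u n <= K / (q n)%:R) ->
  u n @[n --> \oo] --> 0.
Proof.
move=> qoo uK.
have qR : ((q n)%:R : R) @[n --> \oo] --> +oo by exact/cvgrnyP.
have q0 : \forall n \near \oo, 0 < (q n)%:R :> R by exact: ((cvgryPgt _).1 qR).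
have Kq0 : K / (q n)%:R @[n --> \oo] --> (0 : R).
  by rewrite -(mulr0 K); apply: cvgMr; apply: ((gtr0_cvgV0 q0).2 qR).
exact: (squeeze_cvgr (f := fun=> 0) (h := fun n => K / (q n)%:R) uK (cvg_cst _) Kq0).
Qed.

(** The constant 54 is 27 from [n ^ 3 <= 27 * 'C(n, 3)] times 2 from
    [q <= 2 (q - 1)]. *)
Lemma triangle_mean_bound (R : realType) (n q : nat) (d lambda : R) :
  (3 <= n)%N -> (2 <= q)%N -> 0 < d -> 0 < lambda ->
  d ^+ 3 * lambda ^+ 3 / 54 * q%:R
    <= 'C(n, 3)%:R * triangle_prob q (d / n%:R) lambda.
Proof.
move=> n3 q2 d0 l0.
have [_ bin_lb] := bin3_bounds n3.
have n0 : 0 < n%:R :> R by rewrite ltr0n; lia.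
have {}bin_lb : n%:R ^+ 3 <= 27 * 'C(n, 3)%:R :> R.
  by rewrite -natrX -natrM ler_nat.
have {}q2 : 2 <= q%:R :> R by rewrite ler_nat.
have l3 : 0 < lambda ^+ 3 by rewrite exprn_gt0.
have d3 : 0 < d ^+ 3 by rewrite exprn_gt0.
have n30 : 0 < n%:R ^+ 3 :> R by rewrite exprn_gt0.
rewrite /triangle_prob expr_div_n.
apply: (@le_trans _ _ (27^-1 * (d ^+ 3 * (1 + lambda ^+ 3 * (q%:R - 1))))).
  suff : d ^+ 3 * (lambda ^+ 3 * q%:R)
    <= d ^+ 3 * (2 * (1 + lambda ^+ 3 * (q%:R - 1))) by lra.
  by rewrite ler_pM2l //; nra.
set X := 1 + _; have t0 : 0 <= d ^+ 3 * X.
  by rewrite mulr_ge0 ?(ltW d3) // addr_ge0 // mulr_ge0 ?(ltW l3) //; lra.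
rewrite [d ^+ 3 / _ * _]mulrAC [leRHS]mulrA ler_pdivlMr //.
by have := ler_wpM2r t0 bin_lb; lra.
Qed.

Lemma chebyshev_error_bound (R : realType) (c Q D m s : R) :
  0 < c -> 0 < Q -> 0 <= D -> c * Q <= m -> s <= D * Q ->
  4 * (m + s) / m ^+ 2 <= (4 / c + 4 * D / c ^+ 2) / Q.
Proof.
move=> c0 Q0 D0 cm sD.
have cQ0 : 0 < c * Q by rewrite mulr_gt0.
have m0 : 0 < m by exact: lt_le_trans cm.
have mE : m = m / (c * Q) * (c * Q) by rewrite divfK // gt_eqF.
have : 1 <= m / (c * Q) by rewrite ler_pdivlMr // mul1r.
rewrite ler_pdivrMr ?exprn_gt0 //; move: (m / _) mE => r -> r1.
rewrite (_ : _ / Q * _ = 4 * (r ^+ 2 * (c * Q) + r ^+ 2 * (D * Q))); last first.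
  by field; rewrite !gt_eqF.
have r2 : r <= r ^+ 2 by rewrite expr2 ler_peMr //; lra.
have DQ0 : 0 <= D * Q by rewrite mulr_ge0 // ltW.
have r3 : 1 <= r ^+ 2 by lra.
have := ler_wpM2r (ltW cQ0) r2; have := ler_wpM2r DQ0 r3; lra.
Qed.

Theorem theorem1p8 (R : realType) (d lambda : R) (q : nat -> nat)
    (a b : nat -> R)
    (hd : 0 < d) (hlambda : lambda != 0)
    (hq : forall n, (2 <= q n)%N)
    (ha : forall n, 0 < a n) (hb : forall n, 0 < b n)
    (hdE : forall n, d = (a n + ((q n)%:R - 1) * b n) / (q n)%:R)
    (hlambdaE : forall n,
       lambda = (a n - b n) / (a n + ((q n)%:R - 1) * b n))
    (hprob : \forall n \near \oo, a n / n%:R <= 1 /\ b n / n%:R <= 1)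
    (hqoo : q n @[n --> \oo] --> \oo) :
  exists test : nat -> nat -> bool,
    Prob (@sbm R n (q n) (a n) (b n)) (fun G => ~~ test n (triangles G))
      @[n --> \oo] --> 0 /\
    Prob (@erdos_renyi R n (d / n%:R)) (fun G => test n (triangles G))
      @[n --> \oo] --> 0.
Proof.
have q_gt0 n : (0 < q n)%N by apply: leq_trans (hq n).
have aE n := (block_parameters (q_gt0 n) hd (hdE n) (hlambdaE n)).1.
have bE n := (block_parameters (q_gt0 n) hd (hdE n) (hlambdaE n)).2.
have lambda_lt1 : lambda < 1 by have := hb 0%N; rewrite bE pmulr_rgt0 // subr_gt0.
have lambda_gt0 : 0 < lambda.
  (* For negative lambda, a n would be nonpositive as soon as
     q n >= 1 - 1 / lambda. *)
  rewrite lt_neqAle eq_sym hlambda leNgt; apply/negP => lneg.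
  have /cvgryPge/(_ (1 - lambda^-1)) : (q n)%:R @[n --> \oo] --> (+oo%R : set_system R).
    exact/cvgrnyP.
  case=> N _ /(_ N (leqnn N)) /= qN.
  have := ha N; rewrite aE pmulr_rgt0 // ltNge => /negP; apply.
  have : lambda * ((q N)%:R - 1) <= lambda * (- lambda^-1).
    by rewrite (ler_wnM2l (ltW lneg)) //; lra.
  by rewrite mulrN divff //; lra.
pose m n : R := 'C(n, 3)%:R * triangle_prob (q n) (d / n%:R) lambda.
pose c : R := d ^+ 3 * lambda ^+ 3 / 54.
have c0 : 0 < c by rewrite divr_gt0 // mulr_gt0 // exprn_gt0.
have near_bounds : \forall n \near \oo,
    [/\ (3 <= n)%N, a n / n%:R <= 1 & b n / n%:R <= 1].
  by near=> n; split; [near: n; exact: nbhs_infty_ge | |];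
     have [] : a n / n%:R <= 1 /\ b n / n%:R <= 1 by near: n.
exists (fun n k => m n / 2 <= k%:R); split.
- apply: (@cvg_squeeze_divn _ q _ (4 / c + 4 * d ^+ 4 / c ^+ 2) hqoo).
  apply: filterS near_bounds => n [n3 an1 bn1].
  have n0 : 0 < n%:R :> R by rewrite ltr0n; lia.
  have Q0 : 0 < (q n)%:R :> R by rewrite ltr0n.
  have cm : c * (q n)%:R <= m n by exact: triangle_mean_bound.
  have m0 : 0 < m n by apply: lt_le_trans cm; rewrite mulr_gt0.
  have alpha0 : 0 <= d / n%:R by rewrite divr_ge0 // ltW.
  have an : a n / n%:R = d / n%:R * (1 + lambda * ((q n)%:R - 1)).
    by rewrite aE mulrAC.
  have bn : b n / n%:R = d / n%:R * (1 - lambda) by rewrite bE mulrAC.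
  have an01 : 0 <= a n / n%:R <= 1 by rewrite an1 divr_ge0 // ltW.
  have bn01 : 0 <= b n / n%:R <= 1 by rewrite bn1 divr_ge0 // ltW.
  have w0 := @sbm_ge0 R n (q n) _ _ an01 bn01.
  rewrite sumr_ge0 //=.
  rewrite /Prob; under eq_bigl do rewrite -ltNge.
  apply: le_trans (sum_chebyshev w0 (sbm_sum1 (q_gt0 n) an bn) m0
    (sbm_triangles_mean (q_gt0 n) an bn)
    (sbm_triangles_second_moment (q_gt0 n) alpha0 (ltW lambda_gt0) an bn an01 bn01)) _.
  rewrite -/(m n).
  have sq : n%:R ^+ 4 * square_prob (q n) (d / n%:R) lambda <= d ^+ 4 * (q n)%:R.
    rewrite /square_prob expr_div_n mulrA mulrCA divff ?mulr1; last first.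
      by rewrite expf_neq0 // gt_eqF.
    rewrite ler_pM2l ?exprn_gt0 //.
    have l4 : lambda ^+ 4 <= 1 by rewrite exprn_ile1 // ltW.
    have : lambda ^+ 4 * ((q n)%:R - 1) <= 1 * ((q n)%:R - 1).
      by rewrite ler_wpM2r // subr_ge0 ler1n.
    by lra.
  by apply: chebyshev_error_bound cm sq => //; rewrite exprn_ge0 // ltW.
- apply: (@cvg_squeeze_divn _ q _ (2 * d ^+ 3 / c) hqoo).
  apply: filterS near_bounds => n [n3 an1 bn1].
  have n0 : 0 < n%:R :> R by rewrite ltr0n; lia.
  have Q0 : 0 < (q n)%:R :> R by rewrite ltr0n.
  have cm : c * (q n)%:R <= m n by exact: triangle_mean_bound.
  have m0 : 0 < m n by apply: lt_le_trans cm; rewrite mulr_gt0.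
  (* d / n is a convex combination of a / n and b / n. *)
  have p01 : 0 <= d / n%:R <= 1.
    rewrite divr_ge0 ?(ltW hd) //=; have -> : d / n%:R =
      (a n / n%:R + ((q n)%:R - 1) * (b n / n%:R)) / (q n)%:R.
      by rewrite {1}(hdE n); field; rewrite !gt_eqF.
    rewrite ler_pdivrMr // mul1r.
    have : ((q n)%:R - 1) * (b n / n%:R) <= ((q n)%:R - 1) * 1.
      by rewrite ler_wpM2l // subr_ge0 ler1n.
    by lra.
  have w0 (G : graph n) : 0 <= erdos_renyi (d / n%:R) G by exact: indep_edges_ge0.
  rewrite sumr_ge0 //=.
  rewrite /Prob.
  apply: le_trans (@sum_markov R _ _ (fun G => (triangles G)%:R) _ w0 _ _) _ => //.
    by rewrite divr_gt0.
  rewrite erdos_renyi_triangles_mean.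
  have bin_ub : 'C(n, 3)%:R * (d / n%:R) ^+ 3 <= d ^+ 3.
    rewrite expr_div_n mulrCA ger_pMr ?exprn_gt0 // ler_pdivrMr ?exprn_gt0 // mul1r.
    by rewrite -natrX ler_nat; have [] := bin3_bounds n3.
  rewrite ler_pdivrMr ?divr_gt0 //; apply: le_trans bin_ub _.
  rewrite (_ : _ / _ * _ = d ^+ 3 * (m n / (c * (q n)%:R))); last first.
    by field; rewrite !gt_eqF.
  rewrite ler_peMr ?exprn_ge0 ?(ltW hd) //.
  by rewrite ler_pdivlMr ?mul1r // mulr_gt0.
Unshelve. all: end_near.
Qed.
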